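(* Let $\mathbf P=\mathbf M\mathbf U_{\mathbf P}$ be a standard parabolic $F$-subgroup of $\mathbf G$ with Levi subgroup $\mathbf M$, let $R$ be a commutative unital ring, and let $\Gamma\subseteq P$ be a compact open subgroup such that $\Gamma=\Gamma_M\Gamma_{U_P}$, where $\Gamma_M=\Gamma\cap M$ and $\Gamma_{U_P}=\Gamma\cap U_P$. Then the $R$-linear map $$\Theta^P_M=\Theta^P_{M,R}\colon H_R(\Gamma,P)\longrightarrow H_R(\Gamma_M,M),\qquad T^P_g\longmapsto \nu_M(g)\,\mu_{U_P}(g)\cdot T^M_{g_M}$$ is a homomorphism of $R$-algebras.
   Context: Let $F$ be a locally compact non-archimedean field and $\mathbf G$ a connected reductive group over $F$; for an algebraic $F$-group $\mathbf H$ write $H=\mathbf H(F)$ with its natural topology. Fix a minimal parabolic $F$-subgroup $\mathbf B$ and a maximal $F$-split torus $\mathbf T\subseteq\mathbf B$ with centralizer $\mathbf Z$; standard parabolic subgroups are the $F$-parabolics containing $\mathbf B$, and the Levi subgroup $\mathbf M$ of $\mathbf P=\mathbf M\mathbf U_{\mathbf P}$ is the unique one containing $\mathbf Z$; $\mathbf U_{\mathbf P}$ is the unipotent radical. Let $\mathrm{pr}_M\colon P\to M$ be the projection with kernel $U_P$, and write $g_M=\mathrm{pr}_M(g)$ for $g\in P$. For a subgroup $H$ of a group and an element $g$, put $H_{(g)}=H\cap g^{-1}Hg$. For $g\in P$ define the finite indices $$\mu_{U_P}(g)=[\Gamma_{U_P}:(\Gamma_{U_P})_{(g)}],\qquad \nu_M(g)=[(\Gamma_M)_{(g_M)}:\mathrm{pr}_M(\Gamma_{(g)})].$$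 Hecke algebras: for a topological group $X$, a submonoid $S\subseteq X$ containing a compact open subgroup $\Gamma$, let $\mathbb Z[\Gamma\backslash S]$ be the free $\mathbb Z$-module on the right cosets $(\Gamma g)$, $g\in S$, with $S$ acting by right translation, and $H(\Gamma,S)=\mathbb Z[\Gamma\backslash S]^{\Gamma}$. It has $\mathbb Z$-basis $T_g=T_g^S=\sum_{\Gamma h\subseteq \Gamma g\Gamma}(\Gamma h)$, for $\Gamma g\Gamma\in\Gamma\backslash S/\Gamma$, and is a ring with product $\bigl(\sum_i a_i(\Gamma g_i)\bigr)\bigl(\sum_j a'_j(\Gamma g'_j)\bigr)=\sum_{i,j}a_ia'_j(\Gamma g_ig'_j)$ and unit $T_1$. Put $H_R(\Gamma,S)=R\otimes_{\mathbb Z} H(\Gamma,S)$. $T^P_g$ and $T^M_m$ denote the basis elements of $H_R(\Gamma,P)$ and $H_R(\Gamma_M,M)$. *)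

(* Defs.v *)
From HB Require Import structures.
From mathcomp Require Import all_boot all_order all_algebra.
From mathcomp Require Import finmap.
From mathcomp Require Import all_classical all_reals all_analysis.
(* The notations of mpoly clash with those of mathcomp-analysis. *)
From mathcomp Require Import -(notations) mpoly.

Set Implicit Arguments.
Unset Strict Implicit.
Unset Printing Implicit Defensive.

Import GRing.Theory.

Local Open Scope classical_set_scope.
Local Open Scope ring_scope.

Record subgroup (X : groupType) := Subgroup {
  sg_set :> set X;
  sg1 : sg_set 1%g;
  sgM : forall x y, sg_set x -> sg_set y -> sg_set (x * y)%g;
  sgV : forall x, sg_set x -> sg_set (x^-1)%g
}.

Section AbstractGroups.
Variable X : groupType.
Implicit Types (H K : subgroup X) (A : set X).

Fact sgI1 H K : (H `&` K) 1%g.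
Proof. by split; apply: sg1. Qed.
Fact sgIM H K x y : (H `&` K) x -> (H `&` K) y -> (H `&` K) (x * y)%g.
Proof. by move=> [Hx Kx] [Hy Ky]; split; apply: sgM. Qed.
Fact sgIV H K x : (H `&` K) x -> (H `&` K) (x^-1)%g.
Proof. by move=> [Hx Kx]; split; apply: sgV. Qed.

Definition sgI H K : subgroup X :=
  Subgroup (sgI1 H K) (@sgIM H K) (@sgIV H K).

Lemma sgI_subr H K : sgI H K `<=` K.
Proof. exact: subIsetr. Qed.

Definition right_coset (A : set X) (g : X) : set X := [set (a * g)%g | a in A].

Definition right_cosets (A S : set X) : set (set X) := [set right_coset A g | g in S].

(* The index [S : A] of a subgroup A of S; it is 0 if the index is infinite. *)
Definition subgroup_index (S A : set X) : nat := #|` fset_set (right_cosets A S)|.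

(* H_(g), the intersection of H and g^-1 H g. *)
Definition meet_conj (H : set X) (g : X) : set X :=
  H `&` [set (h ^ g)%g | h in H].

Definition normalised_by (S A : set X) : Prop :=
  forall s a, S s -> A a -> A (a ^ s)%g.

Definition derived_group (A : set X) : set X :=
  \bigcap_(H in [set H : subgroup X |
    [set [~ a, b]%g | a in A & b in A] `<=` H]) H.

Definition solvable_group (A : set X) : Prop :=
  exists k, iter k derived_group A = [set 1%g].

End AbstractGroups.

Record GL (n : nat) (k : fieldType) :=
  GLmx { gl_val :> 'M[k]_n; _ : gl_val \in unitmx }.

HB.instance Definition _ n k := [isSub for @gl_val n k].
HB.instance Definition _ n k := [Choice of GL n k by <:].

Section GLGroup.
Variables (n : nat) (k : fieldType).
Implicit Types g h : GL n k.

Lemma gl_unit g : gl_val g \in unitmx. Proof. exact: valP. Qed.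

Fact gl_mul_subproof g h : gl_val g *m gl_val h \in unitmx.
Proof. by rewrite unitmx_mul !gl_unit. Qed.
Fact gl_inv_subproof g : invmx (gl_val g) \in unitmx.
Proof. by rewrite unitmx_inv gl_unit. Qed.

Definition gl_one : GL n k := GLmx (unitmx1 k n).
Definition gl_mul g h : GL n k := GLmx (gl_mul_subproof g h).
Definition gl_inv g : GL n k := GLmx (gl_inv_subproof g).

Fact gl_mulA : associative gl_mul.
Proof. by move=> x y z; apply: val_inj; rewrite /= mulmxA. Qed.
Fact gl_mul1 : left_id gl_one gl_mul.
Proof. by move=> x; apply: val_inj; rewrite /= mul1mx. Qed.
Fact gl_mulr1 : right_id gl_one gl_mul.
Proof. by move=> x; apply: val_inj; rewrite /= mulmx1. Qed.
Fact gl_mulV : left_inverse gl_one gl_inv gl_mul.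
Proof. by move=> x; apply: val_inj; rewrite /= mulVmx ?gl_unit. Qed.
Fact gl_mulrV : right_inverse gl_one gl_inv gl_mul.
Proof. by move=> x; apply: val_inj; rewrite /= mulmxV ?gl_unit. Qed.

HB.instance Definition _ := isGroup.Build (GL n k)
  gl_mulA gl_mul1 gl_mulr1 gl_mulV gl_mulrV.

End GLGroup.

(* A linear algebraic group is identified with its group of points over an
   algebraically closed field k, a Zariski closed subgroup of GL_n(k). *)

Section Zariski.
Variables (n : nat) (k : fieldType).

(* Value at g of a polynomial in the n^2 matrix entries. *)
Definition mx_eval (p : mpoly (n * n) k) (g : GL n k) : k :=
  meval (fun i => mxvec (gl_val g) ord0 i) p.

Definition zariski_closed (X : set (GL n k)) : Prop :=
  exists S : set (mpoly (n * n) k),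
    X = [set g | forall p, S p -> mx_eval p g = 0].

Definition zariski_connected (X : set (GL n k)) : Prop :=
  X !=set0 /\
  forall Y Z : set (GL n k), zariski_closed Y -> zariski_closed Z ->
    X = Y `|` Z -> Y `&` Z = set0 -> Y = set0 \/ Z = set0.

Definition vanishes_on (X : set (GL n k)) (p : mpoly (n * n) k) : Prop :=
  forall g, X g -> mx_eval p g = 0.

Definition unipotent_elt (g : GL n k) : Prop :=
  exists m : nat, (gl_val g - 1%:M) ^+ m = 0.

Definition unipotent_group (X : set (GL n k)) : Prop :=
  forall g, X g -> unipotent_elt g.

Implicit Types G H P U : subgroup (GL n k).

Definition is_unipotent_radical G U : Prop :=
  let admissible H := [/\ H `<=` G, normalised_by G H, zariski_closed H,
                          zariski_connected H & unipotent_group H] in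
  admissible U /\ forall H, admissible H -> H `<=` U.

Definition reductive G : Prop :=
  exists2 U, is_unipotent_radical G U & U = [set 1%g] :> set (GL n k).

Definition is_borel G H : Prop :=
  let admissible H := [/\ H `<=` G, zariski_closed H,
                          zariski_connected H & solvable_group H] in
  admissible H /\ forall H', admissible H' -> H `<=` H' -> H' `<=` H.

Definition is_parabolic G P : Prop :=
  [/\ zariski_closed P, P `<=` G & exists2 H, is_borel G H & H `<=` P].

Definition centralizer (G T : set (GL n k)) : set (GL n k) :=
  [set z | G z /\ forall t, T t -> (z * t = t * z)%g].

End Zariski.

Section OverF.
Variables (F : fieldType) (K : closedFieldType) (iota : {rmorphism F -> K}).

Definition base_change (N : nat) (p : mpoly N F) : mpoly N K :=
  map_mpoly iota p.

(* A Zariski closed set is defined over F if its vanishing ideal is spanned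
   over K by polynomials with coefficients in F. *)
Definition defined_over (n : nat) (X : set (GL n K)) : Prop :=
  forall p, vanishes_on X p ->
    exists s : seq (K * mpoly (n * n) F),
      (forall cq, cq \in s -> vanishes_on X (base_change cq.2)) /\
      p = \sum_(cq <- s) cq.1 *: base_change cq.2.

Definition F_group (n : nat) (X : set (GL n K)) : Prop :=
  zariski_closed X /\ defined_over X.

(* Regular functions on a closed subset of GL_n are the restrictions of the
   quotients p / det^e. *)
Definition F_morphism (n m : nat) (X : set (GL n K)) (Y : set (GL m K))
    (phi : GL n K -> GL m K) : Prop :=
  phi @` X `<=` Y /\
  forall i j, exists (p : mpoly (n * n) F) (e : nat),
    forall g, X g ->
      gl_val (phi g) i j = mx_eval (base_change p) g / \det (gl_val g) ^+ e.

Definition diagonal_torus (r : nat) : set (GL r K) :=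
  [set g | is_diag_mx (gl_val g)].

Section Subgroups.
Variable n : nat.
Implicit Types G B T P M U : subgroup (GL n K).

Definition connected_reductive_F_group G : Prop :=
  [/\ F_group G, zariski_connected G & reductive G].

(* T is F-isomorphic to GL_1^r for some r. *)
Definition F_split_torus T : Prop :=
  F_group T /\
  exists (r : nat) (phi : GL n K -> GL r K) (psi : GL r K -> GL n K),
    [/\ F_morphism T (diagonal_torus (r := r)) phi,
        F_morphism (diagonal_torus (r := r)) T psi,
        forall s t, sg_set T s -> sg_set T t -> phi (s * t)%g = (phi s * phi t)%g,
        forall t, sg_set T t -> psi (phi t) = t
      & forall d, diagonal_torus d -> phi (psi d) = d].

Definition maximal_F_split_torus G T : Prop :=
  [/\ F_split_torus T, T `<=` G
    & forall T', F_split_torus T' -> T' `<=` G -> T `<=` T' -> T' `<=` T].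

Definition parabolic_F_subgroup G P : Prop :=
  is_parabolic G P /\ defined_over P.

Definition minimal_parabolic_F_subgroup G B : Prop :=
  parabolic_F_subgroup G B /\
  forall Q, parabolic_F_subgroup G Q -> Q `<=` B -> B `<=` Q.

(* P is, as an algebraic F-group, the semidirect product of M and its unipotent
   radical U; the last clause says that the product map M x U -> P, which is
   bijective by the preceding ones, is an isomorphism of F-varieties. *)
Definition levi_F_subgroup P U M : Prop :=
  [/\ F_group M,
      P = [set (m * u)%g | m in M & u in U] :> set (GL n K),
      M `&` U = [set 1%g]
    & exists2 pr, F_morphism P M pr &
        forall m u, sg_set M m -> sg_set U u -> pr (m * u)%g = m].

(* The group of F-rational points. *)
Definition F_points_set (X : set (GL n K)) : set (GL n F) :=
  [set g | exists2 h, X h & gl_val h = map_mx iota (gl_val g)].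

Fact F_points1 P : F_points_set P 1%g.
Proof. by exists 1%g; [exact: sg1 | rewrite /= map_mx1]. Qed.
Fact F_pointsM P x y :
  F_points_set P x -> F_points_set P y -> F_points_set P (x * y)%g.
Proof.
move=> [g Pg gE] [h Ph hE]; exists (g * h)%g; first exact: sgM.
by rewrite [LHS]/= gE hE /= map_mxM.
Qed.
Fact F_pointsV P x : F_points_set P x -> F_points_set P (x^-1)%g.
Proof.
move=> [g Pg gE]; exists (g^-1)%g; first exact: sgV.
by rewrite [LHS]/= gE /= map_invmx.
Qed.

Definition F_points P : subgroup (GL n F) :=
  Subgroup (F_points1 P) (@F_pointsM P) (@F_pointsV P).

End Subgroups.

End OverF.

(* The projection onto M with kernel U of the semidirect product M U. *)
Definition levi_proj (X : groupType) (M U : set X) (g : X) : X :=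
  xget 1%g [set m | M m /\ U (m^-1 * g)%g].

#[short(type="topFieldType")]
HB.structure Definition TopField := {F of Topological F & GRing.Field F}.

Definition nonarchimedean_absolute_value (RR : realType) (F : topFieldType)
    (v : F -> RR) : Prop :=
  [/\ forall x, 0 <= v x /\ (v x = 0 <-> x = 0),
      {morph v : x y / x * y},
      forall x y, v (x + y) <= Num.max (v x) (v y),
      exists2 x, x != 0 & v x != 1
    & forall x : F, nbhs x =
        filter_from [set e : RR | 0 < e] (fun e => [set y | v (y - x) < e])].

Definition locally_compact_nonarchimedean (RR : realType) (F : topFieldType) :
    Prop :=
  locally_compact [set: F] /\
  exists v : F -> RR, nonarchimedean_absolute_value v.

(* The natural topology: that of the space of matrices (matrix inversion is
   continuous, so the entries of the inverse need not be taken into account).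
   H(F) gets the subspace topology, for H an algebraic subgroup. *)
HB.instance Definition _ n (F : topFieldType) :=
  Topological.copy (GL n F) (initial_topology (@gl_val n F)).

Definition compact_open_in (T : topologicalType) (S A : set T) : Prop :=
  compact A /\ exists2 O, open O & A = S `&` O.

Section HeckeFunctions.
Variables (R : comPzRingType) (X : groupType) (S Gam : subgroup X).
Implicit Types (f g h : X -> R) (x y : X) (A : set X).

(* R[Gam\S], the free module on the right cosets contained in S: an element
   sum_i a_i (Gam g_i) is encoded by the function on X that sends x to the
   coefficient of the coset Gam x (and vanishes outside S). *)
Definition coset_fun f : Prop :=
  [/\ forall x, ~ sg_set S x -> f x = 0,
      forall c x, sg_set Gam c -> f (c * x)%g = f x
    & finite_set (right_coset Gam @` [set x | f x != 0])].

(* The action of s in S by right translation, (Gam x) |-> (Gam x s). *)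
Definition coset_act f (s : X) : X -> R := fun x => f (x * s^-1)%g.

Definition hecke_fun f : Prop :=
  coset_fun f /\ forall c, sg_set Gam c -> coset_act f c = f.

Definition coset_repr A : X := xget 1%g A.

(* The product: if g = sum_j b_j (Gam g_j), the sum below is
   sum_j b_j f (x g_j^-1), which is the coefficient of (Gam x) in
   sum_(i, j) a_i b_j (Gam f_i g_j) for f = sum_i a_i (Gam f_i). *)
Definition hecke_mulf f g : X -> R := fun x =>
  \sum_(A \in right_cosets Gam S)
    f (x * (coset_repr A)^-1)%g * g (coset_repr A).

(* The sum of the right cosets Gam h contained in Gam g Gam. *)
Definition hecke_basisf (x : X) : X -> R := fun y =>
  (`[< exists c d, [/\ sg_set Gam c, sg_set Gam d & y = (c * x * d)%g] >])%:R.

Hypothesis GamS : Gam `<=` S.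

Let C := right_cosets Gam S.
Let supp f := right_coset Gam @` [set x | f x != 0].

Lemma right_coset_refl x : right_coset Gam x x.
Proof. by exists 1%g; [exact: sg1 | rewrite mul1g]. Qed.

Lemma right_coset_eqP x y :
  right_coset Gam x = right_coset Gam y <-> exists2 c, sg_set Gam c & x = (c * y)%g.
Proof.
split=> [E|[c Gc ->]].
  by have := right_coset_refl x; rewrite E => -[c Gc <-]; exists c.
apply/seteqP; split=> z [d Gd <-].
  by exists (d * c)%g; [exact: sgM | rewrite mulgA].
exists (d * c^-1)%g; first by apply: sgM => //; exact: sgV.
by rewrite mulgA mulgVK.
Qed.

Lemma coset_reprP A : C A -> sg_set S (coset_repr A) /\ right_coset Gam (coset_repr A) = A.
Proof.
move=> [x Sx <-]; have [c Gc E] : right_coset Gam x (coset_repr (right_coset Gam x)).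
  by rewrite /coset_repr; apply: (@xgetPex _ 1%g (right_coset Gam x)); exists x; exact: right_coset_refl.
rewrite -E; split; first by apply: sgM => //; exact: GamS.
by apply/right_coset_eqP; exists c.
Qed.

Lemma coset_repr_rcoset x :
  exists2 c, sg_set Gam c & coset_repr (right_coset Gam x) = (c * x)%g.
Proof.
have [c Gc E] : right_coset Gam x (coset_repr (right_coset Gam x)).
  by rewrite /coset_repr; apply: (@xgetPex _ 1%g (right_coset Gam x)); exists x; exact: right_coset_refl.
by exists c.
Qed.

Let csum (phi : X -> R) : R := \sum_(A \in C) phi (coset_repr A).

Lemma csumE (phi : X -> R) (D : set (set X)) : finite_set D -> D `<=` C ->
    (forall A, C A -> phi (coset_repr A) <> 0 -> D A) ->
  csum phi = \sum_(A <- fset_set D) phi (coset_repr A).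
Proof.
move=> Df DC Dphi; rewrite /csum -fsbig_finite//; apply/esym/fsbig_widen => //.
by move=> A [CA nDA] /=; apply: contra_notP nDA; exact: Dphi.
Qed.

Lemma csum_shift (phi : X -> R) s : sg_set S s ->
    (forall c x, sg_set Gam c -> phi (c * x)%g = phi x) ->
  csum (fun x => phi (x * s)%g) = csum phi.
Proof.
move=> Ss phiG; rewrite /csum.
rewrite [RHS](reindex_fsbig (fun A => right_coset Gam (coset_repr A * s)%g) C C); last first.
  split.
  - by move=> A /coset_reprP[SA _]; exists (coset_repr A * s)%g => //; exact: sgM.
  - move=> A B; rewrite !inE => /coset_reprP[SA AE] /coset_reprP[SB BE].
    move=> /right_coset_eqP[c Gc]; rewrite mulgA => /mulIg E.
    by rewrite -AE -BE; apply/right_coset_eqP; exists c.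
  - move=> A /coset_reprP[SA AE]; exists (right_coset Gam (coset_repr A * s^-1)%g).
      by exists (coset_repr A * s^-1)%g => //; apply: sgM => //; exact: sgV.
    rewrite -[RHS]AE; have [c Gc ->] := coset_repr_rcoset (coset_repr A * s^-1)%g.
    by apply/right_coset_eqP; exists c => //; rewrite -!mulgA mulVg mulg1.
apply: eq_fsbigr => A _.
by have [c Gc ->] := coset_repr_rcoset (coset_repr A * s)%g; rewrite (phiG c).
Qed.

Section Facts.
Variable f : X -> R.
Hypothesis Hf : hecke_fun f.

Lemma hecke_out x : ~ sg_set S x -> f x = 0.
Proof. by case: Hf => -[+ _ _] _; apply. Qed.
Lemma hecke_left c x : sg_set Gam c -> f (c * x)%g = f x.
Proof. by case: Hf => -[_ + _] _; apply. Qed.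
Lemma hecke_right c x : sg_set Gam c -> f (x * c)%g = f x.
Proof.
case: Hf => _ /(_ c^-1%g) E Gc; move: (E (sgV Gc)) => /(congr1 (@^~ x)).
by rewrite /coset_act invgK.
Qed.
Lemma hecke_fin : finite_set (supp f).
Proof. by case: Hf => -[]. Qed.
Lemma hecke_suppC : supp f `<=` C.
Proof.
move=> A [x fx <-]; exists x => //; apply: contrapT => /hecke_out /eqP.
by rewrite (negbTE fx).
Qed.
Lemma hecke_supp A : C A -> f (coset_repr A) <> 0 -> supp f A.
Proof.
by move=> CA f0; have [_ AE] := coset_reprP CA; exists (coset_repr A) => //; exact/eqP.
Qed.
End Facts.

Lemma hecke_mulfE f g (D : set (set X)) x : finite_set D -> D `<=` C ->
    hecke_fun g -> supp g `<=` D ->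
  hecke_mulf f g x =
  \sum_(A <- fset_set D) f (x * (coset_repr A)^-1)%g * g (coset_repr A).
Proof.
move=> Df DC Hg gD.
rewrite -(@csumE (fun y => f (x * y^-1)%g * g y))// => A CA /eqP n0.
apply: gD; apply: hecke_supp => // g0; move: n0.
by rewrite g0 mulr0 eqxx.
Qed.

Let prodD f g : set (set X) :=
  [set right_coset Gam (coset_repr p.1 * coset_repr p.2)%g | p in supp f `*` supp g].

Lemma prodD_fin f g : hecke_fun f -> hecke_fun g -> finite_set (prodD f g).
Proof.
by move=> Hf Hg; apply/finite_image/finite_setX; exact: hecke_fin.
Qed.

Lemma prodD_C f g : hecke_fun f -> hecke_fun g -> prodD f g `<=` C.
Proof.
move=> Hf Hg A [[B E] [/= fB gE] <-].
exists (coset_repr B * coset_repr E)%g => //; apply: sgM.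
  by have [] := coset_reprP (hecke_suppC Hf fB).
by have [] := coset_reprP (hecke_suppC Hg gE).
Qed.

Lemma prodDP f g x y : hecke_fun f -> hecke_fun g ->
  f (x * y^-1)%g != 0 -> g y != 0 -> coset_repr (right_coset Gam y) = y ->
  prodD f g (right_coset Gam x).
Proof.
move=> Hf Hg fn gn yE; exists (right_coset Gam (x * y^-1)%g, right_coset Gam y).
  by split; [exists (x * y^-1)%g | exists y].
rewrite /= yE; have [c Gc ->] := coset_repr_rcoset (x * y^-1)%g.
by apply/right_coset_eqP; exists c => //; rewrite -!mulgA mulVg mulg1.
Qed.

Lemma coset_reprK A : C A -> coset_repr (right_coset Gam (coset_repr A)) = coset_repr A.
Proof. by move=> /coset_reprP[_ ->]. Qed.

Lemma hecke_mulf_n0 f g x : hecke_mulf f g x <> 0 ->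
  exists A, [/\ C A, f (x * (coset_repr A)^-1)%g != 0 & g (coset_repr A) != 0].
Proof.
move=> /eqP n0; have [A CA An0] := fsbigN1
  (f := fun x A => f (x * (coset_repr A)^-1)%g * g (coset_repr A)) n0.
exists A; split=> //; apply: contraNneq An0 => ->; by rewrite ?mul0r ?mulr0.
Qed.

Lemma hecke_mulf_supp f g : hecke_fun f -> hecke_fun g ->
  supp (hecke_mulf f g) `<=` prodD f g.
Proof.
move=> Hf Hg B [x /eqP/hecke_mulf_n0[A [CA fn gn]] <-].
by apply: prodDP fn gn _; rewrite ?coset_reprK.
Qed.

Lemma hecke_mulf_hecke f g : hecke_fun f -> hecke_fun g ->
  hecke_fun (hecke_mulf f g).
Proof.
move=> Hf Hg; split; first split.
- move=> x nSx; apply: contrapT => /hecke_mulf_n0[A [CA fn gn]]; apply: nSx.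
  have [SA _] := coset_reprP CA.
  rewrite -(mulgVK (coset_repr A) x); apply: sgM => //.
  by apply: contrapT => /(hecke_out Hf)/eqP; rewrite (negbTE fn).
- by move=> c x Gc; apply: eq_fsbigr => A _; rewrite -mulgA (hecke_left Hf _ Gc).
- exact: sub_finite_set (hecke_mulf_supp Hf Hg) (prodD_fin Hf Hg).
- move=> c Gc; apply/funext => x; rewrite /coset_act.
  rewrite -[RHS](csum_shift (phi := fun y => f (x * y^-1)%g * g y) (GamS Gc)).
    apply: eq_fsbigr => A _; rewrite (hecke_right Hg _ Gc).
    by rewrite -mulgA -invgM.
  by move=> d y Gd; rewrite (hecke_left Hg _ Gd) invgM mulgA
    (hecke_right Hf _ (sgV Gd)).
Qed.

Lemma hecke_mulfA f g h : hecke_fun f -> hecke_fun g -> hecke_fun h ->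
  hecke_mulf f (hecke_mulf g h) = hecke_mulf (hecke_mulf f g) h.
Proof.
move=> Hf Hg Hh; apply/funext => x.
have [Df DC] := (prodD_fin Hg Hh, prodD_C Hg Hh).
rewrite (hecke_mulfE f x Df DC (hecke_mulf_hecke Hg Hh) (hecke_mulf_supp Hg Hh)).
rewrite (hecke_mulfE _ x (hecke_fin Hh) (hecke_suppC Hh) Hh)//.
under eq_bigr => A _.
  rewrite (hecke_mulfE g _ (hecke_fin Hh) (hecke_suppC Hh) Hh)// mulr_sumr.
  over.
rewrite exchange_big/=; rewrite !big_seq; apply: eq_bigr => B.
rewrite in_fset_set; last exact: hecke_fin.
rewrite inE => hB; have CB := hecke_suppC Hh hB.
have [SB BE] := coset_reprP CB.
under eq_bigr do rewrite mulrA; rewrite -mulr_suml; congr (_ * _).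
set b := coset_repr B in SB BE *.
pose psi y := f (x * y^-1)%g * g (y * b^-1)%g.
rewrite -(@csumE psi _ Df DC).
  rewrite -(csum_shift SB); last first.
    by move=> c y Gc; rewrite /psi invgM -!mulgA (hecke_left Hg _ Gc) mulgA
      (hecke_right Hf _ (sgV Gc)).
  by apply: eq_fsbigr => A _; rewrite /psi mulgK invgM mulgA.
move=> A CA psin; have [_ AE] := coset_reprP CA; rewrite -AE.
apply: (@prodDP _ _ _ b) => //.
- by apply/eqP => g0; apply: psin; rewrite /psi g0 mulr0.
- move: hB => [y hy yE]; have := coset_repr_rcoset y; rewrite yE => -[c Gc bE].
  by rewrite /b bE (hecke_left Hh).
- exact: coset_reprK.
Qed.

Lemma hecke_mulfDl f g h : hecke_fun h ->
  hecke_mulf (f \+ g) h = hecke_mulf f h \+ hecke_mulf g h.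
Proof.
move=> Hh; apply/funext => x /=.
rewrite !(hecke_mulfE _ x (hecke_fin Hh) (hecke_suppC Hh) Hh)// -big_split/=.
by apply: eq_bigr => A _; rewrite mulrDl.
Qed.

Lemma hecke_fun0 : hecke_fun (fun=> 0).
Proof.
split; last by [].
split=> //; apply: (@sub_finite_set _ _ set0) => //.
by move=> A [x]; rewrite /= eqxx.
Qed.

Lemma hecke_funP a f g : hecke_fun f -> hecke_fun g ->
  hecke_fun (fun x => a * f x + g x).
Proof.
move=> Hf Hg; split; first split.
- by move=> x nS; rewrite (hecke_out Hf)// (hecke_out Hg)// mulr0 addr0.
- by move=> c x Gc; rewrite (hecke_left Hf _ Gc) (hecke_left Hg _ Gc).
- apply: (@sub_finite_set _ _ (supp f `|` supp g)).
    move=> A [x n0 <-]; have [f0|fn] := eqVneq (f x) 0; last by left; exists x.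
    by right; exists x => //; move: n0; rewrite /= f0 mulr0 add0r.
  by rewrite finite_setU; split; exact: hecke_fin.
- move=> c Gc; apply/funext => x; rewrite /coset_act.
  by rewrite (hecke_right Hf _ (sgV Gc)) (hecke_right Hg _ (sgV Gc)).
Qed.

Lemma hecke_mulfDr f g h : hecke_fun g -> hecke_fun h ->
  hecke_mulf f (g \+ h) = hecke_mulf f g \+ hecke_mulf f h.
Proof.
move=> Hg Hh; apply/funext => x /=; pose D := supp g `|` supp h.
have Df : finite_set D by rewrite finite_setU; split; exact: hecke_fin.
have DC : D `<=` C by rewrite subUset; split; exact: hecke_suppC.
have Hgh : hecke_fun (g \+ h).
  have := hecke_funP 1 Hg Hh; congr hecke_fun; apply/funext => y.
  by rewrite mul1r.
rewrite !(hecke_mulfE _ x Df DC)//.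
- by rewrite -big_split/=; apply: eq_bigr => A _; rewrite mulrDr.
- exact: subsetUr.
- exact: subsetUl.
- move=> A [y n0 <-]; have [f0|fn] := eqVneq (g y) 0; last by left; exists y.
  by right; exists y => //; move: n0; rewrite /= f0 add0r.
Qed.

Lemma hecke_basisf1 y : hecke_basisf 1%g y = (`[< sg_set Gam y >])%:R.
Proof.
rewrite /hecke_basisf; congr (nat_of_bool _)%:R; apply/asboolP/asboolP.
  by move=> [c [d [Gc Gd ->]]]; rewrite mulg1; exact: sgM.
by move=> Gy; exists y, 1%g; split => //; rewrite ?mulg1//; exact: sg1.
Qed.

Lemma hecke_fun1 : hecke_fun (hecke_basisf 1%g).
Proof.
have GM c x : sg_set Gam c -> sg_set Gam (c * x)%g <-> sg_set Gam x.
  move=> Gc; split=> [Gcx|]; last exact: sgM.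
  by rewrite -(mulKg c x); apply: sgM => //; exact: sgV.
have GMr c x : sg_set Gam c -> sg_set Gam (x * c)%g <-> sg_set Gam x.
  move=> Gc; split=> [Gcx|Gx]; last exact: sgM.
  by rewrite -(mulgK c x); apply: sgM => //; exact: sgV.
split; first split.
- by move=> x nSx; rewrite hecke_basisf1 asboolF// => /GamS.
- by move=> c x Gc; rewrite !hecke_basisf1; congr (nat_of_bool _)%:R; apply: asbool_equiv_eq; exact: GM.
- apply: (@sub_finite_set _ _ [set right_coset Gam 1%g]) => //.
  move=> A [x n0 <-]; apply/right_coset_eqP; exists x; last by rewrite mulg1.
  by apply: contrapT => nG; move: n0; rewrite /= hecke_basisf1 asboolF// eqxx.
- move=> c Gc; apply/funext => x; rewrite /coset_act !hecke_basisf1.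
  congr (nat_of_bool _)%:R; apply: asbool_equiv_eq; apply: GMr; exact: sgV.
Qed.

Lemma hecke_mulf1 f : hecke_fun f -> hecke_mulf f (hecke_basisf 1%g) = f.
Proof.
move=> Hf; apply/funext => x.
have G1 : sg_set Gam (coset_repr (right_coset Gam 1%g)).
  by have [c Gc ->] := coset_repr_rcoset 1%g; rewrite mulg1.
rewrite (@hecke_mulfE _ _ [set right_coset Gam 1%g])//.
- rewrite fset_set1 big_seq_fset1 hecke_basisf1 asboolT// mulr1.
  by rewrite (hecke_right Hf _ (sgV G1)).
- by move=> A ->; exists 1%g => //; exact: sg1.
- exact: hecke_fun1.
- move=> A [y n0 <-]; apply/right_coset_eqP; exists y; last by rewrite mulg1.
  by apply: contrapT => nG; move: n0; rewrite /= hecke_basisf1 asboolF// eqxx.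
Qed.

Lemma hecke_mul1f f : hecke_fun f -> hecke_mulf (hecke_basisf 1%g) f = f.
Proof.
move=> Hf; apply/funext => x.
have [Sx|nSx] := pselect (sg_set S x); last first.
  by rewrite (hecke_out Hf)// (hecke_out (hecke_mulf_hecke hecke_fun1 Hf)).
rewrite /hecke_mulf (_ : \sum_(A \in _) _ = csum (fun y =>
  hecke_basisf 1%g (x * y^-1)%g * f y))//.
have CA : C (right_coset Gam x) by exists x.
have [c Gc cE] := coset_repr_rcoset x.
rewrite (@csumE _ [set right_coset Gam x])//.
- rewrite fset_set1 big_seq_fset1 cE (hecke_left Hf)// hecke_basisf1 asboolT ?mul1r//.
  by rewrite invgM mulgA mulgV mul1g; exact: sgV.
- by move=> A ->.
- move=> A CA' n0; have [_ AE] := coset_reprP CA'; rewrite -AE /=.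
  apply/esym/right_coset_eqP; exists (x * (coset_repr A)^-1)%g; last by rewrite mulgVK.
  by apply: contrapT => nG; apply: n0; rewrite hecke_basisf1 asboolF// mul0r.
Qed.

Lemma hecke_mulfZl a f g : hecke_fun g ->
  (fun x => a * hecke_mulf f g x) = hecke_mulf (fun x => a * f x) g.
Proof.
move=> Hg; apply/funext => x.
rewrite !(hecke_mulfE _ x (hecke_fin Hg) (hecke_suppC Hg) Hg)// mulr_sumr.
by apply: eq_bigr => A _; rewrite mulrA.
Qed.

Lemma hecke_mulfZr a f g : hecke_fun g ->
  (fun x => a * hecke_mulf f g x) = hecke_mulf f (fun x => a * g x).
Proof.
move=> Hg; apply/funext => x.
have Hag : hecke_fun (fun x => a * g x).
  have := hecke_funP a Hg hecke_fun0; congr hecke_fun; apply/funext => y.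
  by rewrite addr0.
rewrite !(hecke_mulfE _ x (hecke_fin Hg) (hecke_suppC Hg))//; last first.
  move=> A [y n0 <-]; exists y => //; apply: contraNneq n0 => ->.
  by rewrite mulr0.
by rewrite mulr_sumr; apply: eq_bigr => A _; rewrite mulrCA.
Qed.

End HeckeFunctions.

Section HeckeAlgebra.
Variables (R : comPzRingType) (X : groupType) (S Gam : subgroup X).
Variable GamS : Gam `<=` S.

Definition hecke_pred : {pred (X -> R^o)} := fun f => `[< hecke_fun S Gam f >].

(* H_R(Gam, S) = R[Gam\S]^Gam; for R = Z this is H(Gam, S), and as the latter is
   free over Z on the T_g, R[Gam\S]^Gam is its base change to R. *)
Record hecke (sub : Gam `<=` S) : Type :=
  Hecke { hecke_val :> X -> R^o; _ : hecke_val \in hecke_pred }.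

Notation H := (hecke GamS).

HB.instance Definition _ := [isSub of H for @hecke_val GamS].
HB.instance Definition _ := [Choice of H by <:].

Fact hecke_submod_closed : submod_closed hecke_pred.
Proof.
split; first exact/asboolP/hecke_fun0.
by move=> a f g /asboolP Hf /asboolP Hg; apply/asboolP/hecke_funP.
Qed.

HB.instance Definition _ :=
  GRing.isSubmodClosed.Build R (X -> R^o) hecke_pred hecke_submod_closed.
HB.instance Definition _ := [SubChoice_isSubLmodule of H by <:].

Lemma heckeP (f : H) : hecke_fun S Gam f.
Proof. exact/asboolP/(valP f). Qed.

Definition hecke_one : H := Hecke GamS (asboolT (hecke_fun1 R GamS)).
Definition hecke_mul (f g : H) : H :=
  Hecke GamS (asboolT (hecke_mulf_hecke GamS (heckeP f) (heckeP g))).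

Fact hecke_mulA : associative hecke_mul.
Proof. by move=> f g h; apply/val_inj/hecke_mulfA => //; exact: heckeP. Qed.
Fact hecke_mul1r : left_id hecke_one hecke_mul.
Proof. by move=> f; apply/val_inj/hecke_mul1f => //; exact: heckeP. Qed.
Fact hecke_mulr1 : right_id hecke_one hecke_mul.
Proof. by move=> f; apply/val_inj/hecke_mulf1 => //; exact: heckeP. Qed.
Fact hecke_mulDl : left_distributive hecke_mul +%R.
Proof. by move=> f g h; apply/val_inj/hecke_mulfDl => //; exact: heckeP. Qed.
Fact hecke_mulDr : right_distributive hecke_mul +%R.
Proof. by move=> f g h; apply/val_inj/hecke_mulfDr => //; exact: heckeP. Qed.

HB.instance Definition _ := GRing.Zmodule_isPzRing.Build H
  hecke_mulA hecke_mul1r hecke_mulr1 hecke_mulDl hecke_mulDr.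

(* Together with the instances above, these make hecke an R-algebra. It cannot
   be declared as such, since algebras are non-trivial rings in MathComp and R
   may be the zero ring. *)
Lemma hecke_scalerAl (a : R) (f g : H) : a *: (f * g) = (a *: f) * g.
Proof. by apply/val_inj/hecke_mulfZl => //; exact: heckeP. Qed.
Lemma hecke_scalerAr (a : R) (f g : H) : a *: (f * g) = f * (a *: g).
Proof. by apply/val_inj/hecke_mulfZr => //; exact: heckeP. Qed.

(* T_g, for g in S. The default value 0 of insubd is only taken if Gam g Gam is
   not a finite union of right cosets, hence never if Gam is compact and open
   in S. *)
Definition hecke_T (g : X) : H := insubd (0 : H) (hecke_basisf R Gam g).

End HeckeAlgebra.

Section Indices.
Variables (X : groupType) (Gam M U : set X).

Definition mu_index (g : X) : nat :=
  subgroup_index (Gam `&` U) (meet_conj (Gam `&` U) g).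

Definition nu_index (g : X) : nat :=
  subgroup_index (meet_conj (Gam `&` M) (levi_proj M U g))
        (levi_proj M U @` meet_conj Gam g).

End Indices.

(* Main.v *)
From HB Require Import structures.
Require Import Defs.
From mathcomp Require Import all_boot all_order all_algebra.
From mathcomp Require Import finmap.
From mathcomp Require Import all_classical all_reals all_analysis.
From mathcomp Require Import -(notations) mpoly.

Set Implicit Arguments.
Unset Strict Implicit.
Unset Printing Implicit Defensive.

Import GRing.Theory.

Local Open Scope classical_set_scope.
Local Open Scope ring_scope.

(** The theorem is a statement about an abstract group [P] that is a semidirect
product of [M] and a normal subgroup [U]. The projection [pr : P -> M] is a
group morphism with [pr Gam = GamM], so that
[(Gam a) |-> (GamM pr a)] is a well-defined linear map from [R[Gam\P]] to
[R[GamM\M]]. It is compatible with right translations, hence maps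
[Gam]-invariants to [GamM]-invariants, and it is multiplicative because the
product of the Hecke algebras is computed on representatives of right cosets.
This map is [Theta] ([levi_push]); being a morphism of algebras is therefore a
formal matter ([levi_pushf_hecke], [levi_pushf_mul], [levi_pushf_basis1]), and
the content of the theorem is the value of [Theta] on the basis
([levi_push_T]).

The coefficient of [(GamM m)] in [Theta T_g] is the number of right cosets
[Gam a] in [Gam g Gam] with [pr a] in [GamM m]. As [Theta T_g] is invariant
under [GamM] on both sides and supported on [GamM (pr g) GamM], it is a multiple
of the basis element of [pr g], and the multiple is the number of cosets
[Gam g c] with [c] in [Gam] and [pr c] in [L], where [L] is
[(GamM)_(pr g)]. Writing [c = u m] with [u] in [GamU] and [m] in [L], such a coset
determines the class of [m] modulo [pr (Gam_(g))]; once [m] is a chosen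
representative of its class, it also determines the class of [u] modulo
[(GamU)_(g)], and any two classes occur. This gives [nu g * mu g]
([ncard_levi_fibre]).

A linear map on the Hecke algebra is determined by its values on the [T_g]: this
is [hecke_linear_ext], by induction on the number of cosets in the support.

It remains to see that the rational points of the algebraic groups form such a
semidirect product. Here rationality of the projection is what matters: it is a
morphism over [F], so it maps [F]-points of [P] to [F]-points of [M]
([F_points_levi]).

Infinite indices and infinite double cosets have conventional values ([0] for the
index, and the zero element for [T_g]). The formula for [Theta T_g] respects these
conventions: if [Gam g Gam] is an infinite union of right cosets, then either
its image in [M] is one, or the fibre counted by [nu g * mu g] is infinite
([dcosets_finite]). *)

(** * Cardinals of possibly infinite sets *)

Local Notation ncard A := #|` fset_set A|.

Lemma ncard_infinite (T : choiceType) (A : set T) : ~ finite_set A -> ncard A = 0%N.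
Proof. by move=> Ainf; rewrite /fset_set; case: pselect. Qed.

Lemma finite_setXl (S T : Type) (A : set S) (B : set T) :
  B !=set0 -> finite_set (A `*` B) -> finite_set A.
Proof.
move=> [b Bb] fAB; apply: (sub_finite_set _ (finite_image fst fAB)).
by move=> a Aa; exists (a, b).
Qed.

Lemma finite_setXr (S T : Type) (A : set S) (B : set T) :
  A !=set0 -> finite_set (A `*` B) -> finite_set B.
Proof.
move=> [a Aa] fAB; apply: (sub_finite_set _ (finite_image snd fAB)).
by move=> b Bb; exists (a, b).
Qed.

Lemma ncard_setX (S T : choiceType) (A : set S) (B : set T) :
  A !=set0 -> B !=set0 -> ncard (A `*` B) = (ncard A * ncard B)%N.
Proof.
move=> A0 B0; have [fA|iA] := pselect (finite_set A); last first.
  by rewrite (ncard_infinite iA) ncard_infinite// => /(finite_setXl B0).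
have [fB|iB] := pselect (finite_set B); last first.
  by rewrite (ncard_infinite iB) muln0 ncard_infinite// => /(finite_setXr A0).
rewrite fset_setX// -(size_allpairs pair); apply/perm_size/uniq_perm => //.
  by apply: allpairs_uniq => // -[a b] [c d].
move=> [a b]; rewrite in_fsetM/=; apply/idP/allpairsP => [/andP[aA bB]|].
  by exists (a, b).
by move=> [[c d] [/= cA dB [-> ->]]]; rewrite cA dB.
Qed.

Lemma set_bij_finite (S T : choiceType) (A : set S) (B : set T) (f : S -> T) :
  set_bij A B f -> finite_set B -> finite_set A.
Proof.
move=> [fAB finj _] fB; rewrite -(eq_finite_set (inj_card_eq finj)).
by apply: (sub_finite_set _ fB) => y [x Ax <-]; exact: fAB.
Qed.

Lemma ncard_set_bij (S T : choiceType) (A : set S) (B : set T) (f : S -> T) :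
  set_bij A B f -> ncard A = ncard B.
Proof.
move=> bf; have [fB|iB] := pselect (finite_set B); last first.
  rewrite (ncard_infinite iB) ncard_infinite// => fA; apply: iB.
  by case: bf => _ _ fBA; apply: (sub_finite_set fBA); exact: finite_image.
have fA := set_bij_finite bf fB.
have -> : B = f @` A.
  by case: bf => fAB _ fBA; apply/seteqP; split=> // y [x Ax <-]; exact: fAB.
rewrite fset_set_image// card_in_imfset//= => x y.
by rewrite !in_fset_set//; case: bf => _ + _; apply.
Qed.

(** * Right cosets and the subgroups [H_(g)] *)

Section Cosets.
Variable X : groupType.
Implicit Types (H : subgroup X) (x y g : X).

Lemma right_coset_eqE H x y :
  right_coset H x = right_coset H y <-> sg_set H (x * y^-1)%g.
Proof.
rewrite right_coset_eqP; split=> [[c Hc ->]|Hxy]; first by rewrite mulgK.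
by exists (x * y^-1)%g => //; rewrite mulgVK.
Qed.

Lemma sgMl H c x : sg_set H c -> sg_set H (c * x)%g <-> sg_set H x.
Proof.
move=> Hc; split=> [Hcx|]; last exact: sgM.
by rewrite -(mulKg c x); apply: sgM => //; exact: sgV.
Qed.

Lemma sgMr H c x : sg_set H c -> sg_set H (x * c)%g <-> sg_set H x.
Proof.
move=> Hc; split=> [Hxc|Hx]; last exact: sgM.
by rewrite -(mulgK c x); apply: sgM => //; exact: sgV.
Qed.

Lemma sgVE H x : sg_set H x^-1%g <-> sg_set H x.
Proof. by split=> /sgV; rewrite ?invgK. Qed.

Lemma meet_conjE H g x :
  meet_conj H g x <-> sg_set H x /\ sg_set H (g * x * g^-1)%g.
Proof.
split=> [[Hx [h Hh xE]]|[Hx Hgx]]; split=> //.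
  by rewrite -xE conjgE !mulgA mulgV mul1g mulgK.
by exists (g * x * g^-1)%g => //; rewrite conjgE !mulgA mulVg mul1g mulgVK.
Qed.

Lemma meet_conj_subgroup H g :
  exists K : subgroup X, K = meet_conj H g :> set X.
Proof.
have K1 : meet_conj H g 1%g by apply/meet_conjE; rewrite mulg1 mulgV; split; exact: sg1.
have KM x y : meet_conj H g x -> meet_conj H g y -> meet_conj H g (x * y)%g.
  move=> /meet_conjE[Hx Hgx] /meet_conjE[Hy Hgy]; apply/meet_conjE.
  split; first exact: sgM.
  have -> : (g * (x * y) * g^-1 = (g * x * g^-1) * (g * y * g^-1))%g.
    by rewrite !mulgA mulgVK.
  exact: sgM.
have KV x : meet_conj H g x -> meet_conj H g (x^-1)%g.
  move=> /meet_conjE[Hx Hgx]; apply/meet_conjE; split; first exact: sgV.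
  by have := sgV Hgx; rewrite !invgM invgK mulgA.
by exists (Subgroup K1 KM KV).
Qed.

End Cosets.

(** * The projection of a semidirect product *)

Section Levi.
Variables (X : groupType) (P M U : subgroup X).
Hypotheses (MP : M `<=` P) (UnP : normalised_by P U).
Hypothesis (PMU : forall g, sg_set P g ->
  exists m u, [/\ sg_set M m, sg_set U u & g = (m * u)%g]).
Hypothesis (MU1 : M `&` U `<=` [set 1%g]).
Local Notation pr := (levi_proj M U).

Lemma levi_proj_unique g m : sg_set M m -> sg_set U (m^-1 * g)%g -> pr g = m.
Proof.
move=> Mm Um; apply: xget_unique => // y [My Uy].
have : (M `&` U) (m^-1 * y)%g.
  split; first by apply: sgM => //; exact: sgV.
  by have := sgM Um (sgV Uy); rewrite invgM invgK -!mulgA mulVKg.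
by move=> /MU1/= /(congr1 (fun x => m * x)%g); rewrite mulVKg mulg1.
Qed.

Lemma levi_projP g : sg_set P g -> sg_set M (pr g) /\ sg_set U ((pr g)^-1 * g)%g.
Proof.
move=> /PMU[m [u [Mm Uu ->]]].
by rewrite (@levi_proj_unique _ m)// mulKg.
Qed.

(** Normality of [U] moves the [U]-part of [g] past [pr h]. *)
Lemma levi_projM g h : sg_set P g -> sg_set P h -> pr (g * h)%g = (pr g * pr h)%g.
Proof.
move=> Pg Ph; have [Mg Ug] := levi_projP Pg; have [Mh Uh] := levi_projP Ph.
apply: levi_proj_unique; first exact: sgM.
have -> : ((pr g * pr h)^-1 * (g * h) = ((pr g)^-1 * g) ^ (pr h) * ((pr h)^-1 * h))%g.
  by rewrite conjgE invgM !mulgA mulgK.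
by apply: sgM => //; apply: UnP => //; exact: MP.
Qed.

Lemma levi_proj_id m : sg_set M m -> pr m = m.
Proof. by move=> Mm; apply: levi_proj_unique => //; rewrite mulVg; exact: sg1. Qed.

Lemma levi_projU u : sg_set U u -> pr u = 1%g.
Proof.
by move=> Uu; apply: levi_proj_unique; rewrite ?invg1 ?mul1g//; exact: sg1.
Qed.

Lemma levi_proj_ker g : sg_set P g -> pr g = 1%g -> sg_set U g.
Proof. by move=> /levi_projP[_] + E; rewrite E invg1 mul1g. Qed.

Lemma levi_projV g : sg_set P g -> pr g^-1%g = (pr g)^-1%g.
Proof.
move=> Pg; apply: (mulIg (pr g)); rewrite mulVg -levi_projM//; last exact: sgV.
by rewrite mulVg levi_proj_id//; exact: sg1.
Qed.

End Levi.


(** * The basis of the Hecke algebra *)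

Section DoubleCosets.
Variables (R : comPzRingType) (X : groupType) (S H : subgroup X).
Hypothesis HS : H `<=` S.

(** The double coset [H x H], as a set of right cosets. *)
Definition dcosets (x : X) : set (set X) := [set right_coset H (x * c)%g | c in H].

Lemma dcosetsP x y : dcosets x (right_coset H y) <->
  exists c d, [/\ sg_set H c, sg_set H d & y = (c * x * d)%g].
Proof.
split=> [[d Hd /esym/right_coset_eqP[c Hc ->]]|[c [d [Hc Hd ->]]]].
  by exists c, d; rewrite mulgA.
by exists d => //; apply/esym/right_coset_eqP; exists c; rewrite ?mulgA.
Qed.

Lemma hecke_basisfE x y :
  hecke_basisf R H x y = (`[< dcosets x (right_coset H y) >])%:R.
Proof.
rewrite /hecke_basisf; congr (nat_of_bool _)%:R.
by apply: asbool_equiv_eq; rewrite dcosetsP.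
Qed.

Lemma hecke_basisf_fun x : sg_set S x -> finite_set (dcosets x) ->
  hecke_fun S H (hecke_basisf R H x).
Proof.
move=> Sx fx; split; first split.
- move=> y nSy; rewrite hecke_basisfE asboolF// dcosetsP.
  move=> [c [d [Hc Hd yE]]]; apply: nSy; rewrite yE.
  by apply: sgM; [apply: sgM => //; exact: HS | exact: HS].
- move=> c y Hc; rewrite !hecke_basisfE; congr (`[< dcosets x _ >])%:R.
  by apply/right_coset_eqP; exists c.
- apply: (sub_finite_set _ fx) => A [y n0 <-].
  by apply: contrapT => nx; move: n0; rewrite /= hecke_basisfE asboolF// eqxx.
- move=> c Hc; apply/funext => y; rewrite /coset_act !hecke_basisfE.
  congr (nat_of_bool _)%:R; apply: asbool_equiv_eq; rewrite !dcosetsP.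
  split=> -[a [b [Ha Hb yE]]].
    exists a, (b * c)%g; split=> //; first exact: sgM.
    by rewrite mulgA -yE mulgVK.
  exists a, (b * c^-1)%g; split=> //; last by rewrite yE !mulgA.
  by apply: sgM => //; exact: sgV.
Qed.

Lemma hecke_T_finite x : sg_set S x -> finite_set (dcosets x) ->
  hecke_val (hecke_T R HS x) = hecke_basisf R H x.
Proof. by move=> Sx fx; apply: insubdK; apply/asboolP/hecke_basisf_fun. Qed.

(** If [1 <> 0] in [R], the indicator function of [H x H] has infinite support, so
that [hecke_T] takes its default value; over the zero ring everything is [0]. *)
Lemma hecke_T_infinite x : ~ finite_set (dcosets x) -> hecke_T R HS x = 0.
Proof.
move=> ifx; rewrite /hecke_T /insubd; case: insubP => // u /asboolP Hu uE.
apply: val_inj; rewrite uE; apply/funext => y.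
have [r0|r1] := eqVneq (1 : R) 0.
  by rewrite -[LHS]mulr1 -[RHS]mulr1 r0 !mulr0.
exfalso; apply: ifx; apply: (sub_finite_set _ (hecke_fin Hu)) => A [c Hc <-].
exists (x * c)%g => //=; rewrite hecke_basisfE asboolT//; exact: imageP.
Qed.

(** The elements [T_x] span: a Hecke function [f] with [f x <> 0] is constant on
[H x H], so subtracting [f x] times [T_x] removes all cosets of [H x H] from its
support and adds none. *)
Lemma hecke_linear_ext (V : lmodType R) (phi psi : {linear hecke R HS -> V}) :
  (forall x, sg_set S x -> phi (hecke_T R HS x) = psi (hecke_T R HS x)) ->
  phi =1 psi.
Proof.
move=> Tphi f.
pose supp (h : hecke R HS) := right_coset H @` [set x | h x != 0].
move: {2}(ncard (supp f)).+1 (ltnSn (ncard (supp f))) => k.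
elim: k f => // k IH f fk.
have [f0|] := pselect (exists x, f x != 0); last first.
  move=> /forallNP f0; suff -> : f = 0 by rewrite !linear0.
  by apply/val_inj/funext => x; have /negP := f0 x; rewrite negbK => /eqP.
case: f0 => x fx; have Hf := heckeP f.
have Sx : sg_set S x.
  by apply: contrapT => /(hecke_out Hf) /eqP; rewrite (negbTE fx).
have ffin : finite_set (supp f) := hecke_fin Hf.
have xf : dcosets x `<=` supp f.
  by move=> A [c Hc <-]; exists (x * c)%g => //=; rewrite (hecke_right Hf _ Hc).
have xfin := sub_finite_set xf ffin.
have TE := hecke_T_finite Sx xfin.
have [f' f'_def] : exists f' : hecke R HS, f' = f - (f x : R) *: hecke_T R HS x.
  by eexists.
have f'E y : f' y = f y - f x * hecke_basisf R H x y.
  by rewrite f'_def -TE.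
have sub : supp f' `<=` supp f `\ right_coset H x.
  move=> A [y /= + <-]; rewrite f'E hecke_basisfE.
  case: asboolP => [/dcosetsP[c [d [Hc Hd yE]]]|nxy].
    by rewrite yE (hecke_right Hf _ Hd) (hecke_left Hf _ Hc) mulr1 subrr eqxx.
  rewrite mulr0 subr0 => fy; split; first by exists y.
  by move=> /= yx; apply: nxy; rewrite yx; exists 1%g; rewrite ?mulg1//; exact: sg1.
have fx_supp : supp f (right_coset H x) by exists x.
have lt_supp : (ncard (supp f') < ncard (supp f))%N.
  have f'fin : finite_set (supp f') := hecke_fin (heckeP f').
  apply: fproper_ltn_card; rewrite fproperEneq; apply/andP; split; last first.
    by apply/fsubsetP => A; rewrite !in_fset_set// !inE => /sub[].
  apply/eqP => /fsetP/(_ (right_coset H x)); rewrite !in_fset_set//.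
  by rewrite (mem_set fx_supp) => /set_mem/sub[_]; apply.
have fE : f = f' + (f x : R) *: hecke_T R HS x by rewrite f'_def subrK.
rewrite fE !linearD !linearZ Tphi// IH//.
by apply: leq_trans lt_supp _; rewrite -ltnS.
Qed.

End DoubleCosets.


(** * The map induced on right cosets by the projection *)

Section LeviPush.
Variables (X : groupType) (P M U : subgroup X).
Hypotheses (MP : M `<=` P) (UnP : normalised_by P U).
Hypothesis (PMU : forall g, sg_set P g ->
  exists m u, [/\ sg_set M m, sg_set U u & g = (m * u)%g]).
Hypothesis (MU1 : M `&` U `<=` [set 1%g]).
Local Notation pr := (levi_proj M U).
Variables (R : comPzRingType) (Gam : subgroup X).
Hypothesis GamP : Gam `<=` P.
Hypothesis GamMU :
  Gam `<=` [set (m * u)%g | m in sgI Gam M & u in sgI Gam U].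
Local Notation GamM := (sgI Gam M).
Let GamMM : GamM `<=` M := @sgI_subr _ Gam M.
Local Notation C := (right_cosets Gam P).
Local Notation CM := (right_cosets GamM M).
Local Notation supp f := (right_coset Gam @` [set x | f x != 0]).
Implicit Types (f : X -> R) (g : X).

Let prM g h (Pg : sg_set P g) (Ph : sg_set P h) := levi_projM MP UnP PMU MU1 Pg Ph.
Let prP g (Pg : sg_set P g) := levi_projP PMU MU1 Pg.

Lemma levi_proj_Gam c : sg_set Gam c -> sg_set GamM (pr c).
Proof.
move=> /GamMU[m [Gm Mm] [u [Gu Uu] <-]].
by rewrite (@levi_proj_unique _ _ _ MU1 _ m)// mulKg.
Qed.

(** The coefficient at [m] of the basis element [(GamM pr a)]. *)
Definition levi_ind (a m : X) : R := (`[< sg_set GamM (pr a * m^-1)%g >])%:R.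

Lemma levi_ind_left c a m : sg_set Gam c -> sg_set P a ->
  levi_ind (c * a)%g m = levi_ind a m.
Proof.
move=> Gc Pa; rewrite /levi_ind prM//; last exact: GamP.
congr (nat_of_bool _)%:R; apply: asbool_equiv_eq; rewrite -mulgA.
by apply: sgMl; exact: levi_proj_Gam.
Qed.

Lemma levi_ind_out a m : sg_set P a -> ~ sg_set M m -> levi_ind a m = 0.
Proof.
move=> Pa nMm; rewrite /levi_ind asboolF// => -[_ Mam]; apply: nMm.
by apply/sgVE; have [Ma _] := prP Pa; apply/(sgMl _ Ma).
Qed.

Lemma levi_ind_neq0 a m : levi_ind a m <> 0 ->
  right_coset GamM m = right_coset GamM (pr a).
Proof.
move=> n0; apply/esym/right_coset_eqE; apply: contrapT => nG.
by apply: n0; rewrite /levi_ind asboolF.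
Qed.

Lemma levi_ind_coset a m c : sg_set GamM c -> levi_ind a (c * m)%g = levi_ind a m.
Proof.
move=> Gc; congr (nat_of_bool _)%:R; apply: asbool_equiv_eq.
by rewrite invgM mulgA; apply: sgMr; exact: sgV.
Qed.

(** The image of [f] under the linear map [(Gam a) |-> (GamM pr a)]. *)
Definition levi_pushf f : X -> R := fun m =>
  \sum_(A \in C) f (coset_repr A) * levi_ind (coset_repr A) m.

Lemma levi_pushfE f (D : set (set X)) m : finite_set D -> D `<=` C ->
    hecke_fun P Gam f -> supp f `<=` D ->
  levi_pushf f m =
  \sum_(A <- fset_set D) f (coset_repr A) * levi_ind (coset_repr A) m.
Proof.
move=> Df DC Hf fD; rewrite /levi_pushf.
rewrite (@csumE _ _ _ _ (fun x => f x * levi_ind x m) _ Df DC)//.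
move=> A CA n0; apply: fD; apply: (hecke_supp GamP CA) => f0.
by apply: n0; rewrite f0 mul0r.
Qed.

Lemma levi_pushf_neq0 f m : levi_pushf f m <> 0 ->
  exists A, [/\ C A, f (coset_repr A) != 0 &
    right_coset GamM m = right_coset GamM (pr (coset_repr A))].
Proof.
move=> /eqP n0; have [A CA An0] := fsbigN1
  (f := fun m A => f (coset_repr A) * levi_ind (coset_repr A) m) n0.
exists A; split=> //; first by apply: contraNneq An0 => ->; rewrite mul0r.
by apply: levi_ind_neq0 => i0; move: An0; rewrite i0 mulr0 eqxx.
Qed.

(** The image of the support of [f], a finite set of cosets that contains the
support of [levi_pushf f]. *)
Let pushD f := [set right_coset GamM (pr (coset_repr A)) | A in supp f].

Lemma pushD_fin f : hecke_fun P Gam f -> finite_set (pushD f).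
Proof. by move=> Hf; apply: finite_image; exact: hecke_fin Hf. Qed.

Lemma pushD_C f : hecke_fun P Gam f -> pushD f `<=` CM.
Proof.
move=> Hf B [A sA <-]; exists (pr (coset_repr A)) => //.
by have [PA _] := coset_reprP GamP (hecke_suppC Hf sA); have [] := prP PA.
Qed.

Lemma levi_pushf_supp f : hecke_fun P Gam f ->
  right_coset GamM @` [set x | levi_pushf f x != 0] `<=` pushD f.
Proof.
move=> Hf B [m /eqP/levi_pushf_neq0[A [CA fA mE]] <-].
by exists A => //; apply: (hecke_supp GamP CA); exact/eqP.
Qed.

(** Compatibility with right translations: the image of [f] translated by [b] is
the image of [f] translated by [pr b]. Both the invariance of [levi_pushf f] and
its multiplicativity come from this. *)
Lemma levi_pushf_shift f b m : hecke_fun P Gam f -> sg_set P b ->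
  \sum_(A \in C) f (coset_repr A * b^-1)%g * levi_ind (coset_repr A) m =
  levi_pushf f (m * (pr b)^-1)%g.
Proof.
move=> Hf Pb.
rewrite -(csum_shift (phi := fun a => f (a * b^-1)%g * levi_ind a m) GamP Pb).
  apply: eq_fsbigr => A; rewrite inE => /(coset_reprP GamP)[PA _].
  by rewrite mulgK /levi_ind prM// invgM invgK mulgA.
move=> c a Gc; rewrite -mulgA (hecke_left Hf _ Gc).
have [Pa|nPa] := pselect (sg_set P a); first by rewrite levi_ind_left.
rewrite (hecke_out Hf) ?mul0r// => Pab; apply: nPa.
by apply/(sgMr _ (sgV Pb)).
Qed.

Lemma levi_pushf_hecke f : hecke_fun P Gam f -> hecke_fun M GamM (levi_pushf f).
Proof.
move=> Hf; split; first split.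
- move=> m nMm; rewrite /levi_pushf; apply: fsbig1 => A.
  move=> /(coset_reprP GamP)[PA _].
  by rewrite levi_ind_out// mulr0.
- by move=> c m Gc; apply: eq_fsbigr => A _; rewrite levi_ind_coset.
- exact: sub_finite_set (levi_pushf_supp Hf) (pushD_fin Hf).
- move=> c [Gc Mc]; apply/funext => m; rewrite /coset_act.
  rewrite -[X in (m * X^-1)%g](levi_proj_id MU1 Mc) -levi_pushf_shift//; last first.
    exact: GamP.
  by apply: eq_fsbigr => A _; rewrite (hecke_right Hf)//; exact: sgV.
Qed.

Lemma levi_pushf_basis1 : levi_pushf (hecke_basisf R Gam 1%g) = hecke_basisf R GamM 1%g.
Proof.
apply/funext => m; have H1 := hecke_fun1 R GamP.
rewrite (@levi_pushfE _ [set right_coset Gam 1%g])//.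
- rewrite fset_set1 big_seq_fset1 !hecke_basisf1.
  have [c Gc ->] := coset_repr_rcoset Gam 1%g.
  rewrite mulg1 asboolT// mul1r /levi_ind; congr (nat_of_bool _)%:R.
  apply: asbool_equiv_eq.
  by rewrite -(sgVE _ m); apply: sgMl; exact: levi_proj_Gam.
- by move=> A ->; exists 1%g => //; exact: sg1.
- move=> A [y n0 <-]; apply/right_coset_eqP; exists y; last by rewrite mulg1.
  by apply: contrapT => nG; move: n0; rewrite /= hecke_basisf1 asboolF// eqxx.
Qed.

Lemma levi_pushf_linear a f (g : X -> R) : hecke_fun P Gam f -> hecke_fun P Gam g ->
  levi_pushf (fun x => a * f x + g x) = (fun x => a * levi_pushf f x + levi_pushf g x).
Proof.
move=> Hf Hg; apply/funext => m; pose D := supp f `|` supp g.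
have Df : finite_set D.
  by rewrite finite_setU; split; [exact: hecke_fin Hf | exact: hecke_fin Hg].
have DC : D `<=` C.
  by rewrite subUset; split; [exact: hecke_suppC Hf | exact: hecke_suppC Hg].
rewrite !(@levi_pushfE _ D)//.
- rewrite mulr_sumr -big_split/=; apply: eq_bigr => A _.
  by rewrite mulrDl mulrA.
- exact: subsetUr.
- exact: subsetUl.
- exact: hecke_funP.
- move=> A [x n0 <-]; have [f0|fn] := eqVneq (f x) 0; last by left; exists x.
  by right; exists x => //; move: n0; rewrite /= f0 mulr0 add0r.
Qed.

(** Expanding [g] as a sum of cosets [(Gam b)], both sides become the sum over [b]
of [g b] times the translate of [levi_pushf f] by [pr b]. *)
Lemma levi_pushf_mul f (g : X -> R) : hecke_fun P Gam f -> hecke_fun P Gam g ->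
  levi_pushf (hecke_mulf P Gam f g) =
  hecke_mulf M GamM (levi_pushf f) (levi_pushf g).
Proof.
move=> Hf Hg; apply/funext => m.
have [Df DC Ds] := And3 (prodD_fin Hf Hg) (prodD_C GamP Hf Hg)
  (hecke_mulf_supp GamP Hf Hg).
rewrite (levi_pushfE m Df DC (hecke_mulf_hecke GamP Hf Hg) Ds).
rewrite (hecke_mulfE GamMM (levi_pushf f) m (pushD_fin Hg) (pushD_C Hg)
  (levi_pushf_hecke Hg) (levi_pushf_supp Hg)).
have [gf gC] := (hecke_fin Hg, hecke_suppC Hg).
under eq_bigr => A _.
  rewrite (hecke_mulfE GamP f _ gf gC Hg)// mulr_suml.
  over.
under [RHS]eq_bigr => A _.
  rewrite (levi_pushfE _ gf gC Hg)// mulr_sumr.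
  over.
rewrite exchange_big [RHS]exchange_big/= !big_seq; apply: eq_bigr => B.
rewrite in_fset_set// inE => gB.
have [PB BE] := coset_reprP GamP (gC _ gB).
set b := coset_repr B in PB BE *.
have gb : g b != 0.
  move: gB => [y gy yE]; have := coset_repr_rcoset Gam y; rewrite yE => -[c Gc bE].
  by rewrite /b bE (hecke_left Hg).
(* The contribution of the single coset [Gam b] of the support of [g]. *)
transitivity (g b * levi_pushf f (m * (pr b)^-1)%g).
  rewrite -levi_pushf_shift// (@csumE _ _ _ _
    (fun a => f (a * b^-1)%g * levi_ind a m) _ Df DC)//.
    by rewrite mulr_sumr; apply: eq_bigr => A _; rewrite mulrAC [RHS]mulrC.
  move=> A CA n0; have [_ <-] := coset_reprP GamP CA.
  apply: (prodDP (y := b) Hf Hg) => //.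
    by apply/eqP => f0; apply: n0; rewrite f0 mul0r.
  by rewrite BE.
have Mb : sg_set M (pr b) by have [] := prP PB.
have HT := levi_pushf_hecke Hf.
pose phi d := levi_pushf f (m * d^-1)%g * (g b * levi_ind b d).
rewrite -(@csumE _ _ _ _ phi _ (pushD_fin Hg) (pushD_C Hg)); last first.
  move=> A CA n0; have [_ AE] := coset_reprP GamMM CA.
  exists B => //; rewrite -AE; apply/esym/levi_ind_neq0 => i0; apply: n0.
  by rewrite /phi i0 !mulr0.
(* Only the coset of [pr b] contributes to the sum over [GamM\M]. *)
rewrite (@csumE _ _ _ _ phi [set right_coset GamM (pr b)])//.
- rewrite fset_set1 big_seq_fset1; have [c Gc ->] := coset_repr_rcoset GamM (pr b).
  rewrite /phi invgM mulgA (hecke_right HT _ (sgV Gc)).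
  rewrite levi_ind_coset// /levi_ind mulgV asboolT; last exact: sg1.
  by rewrite mulr1 mulrC.
- by move=> A ->; exists (pr b).
- move=> A CA n0; have [_ AE] := coset_reprP GamMM CA.
  rewrite -AE; apply: levi_ind_neq0 => i0; apply: n0.
  by rewrite /phi i0 !mulr0.
Qed.


(** * The coefficient nu mu *)

(** The right cosets [Gam a] in [Gam g Gam] that lie over [GamM pr g]; their number
is the coefficient of [T_(pr g)] in the image of [T_g]. *)
Definition levi_fibre g : set (set X) :=
  [set A | dcosets Gam g A /\
           right_coset GamM (pr (coset_repr A)) = right_coset GamM (pr g)].

Lemma right_coset_levi_repr x : sg_set P x ->
  right_coset GamM (pr (coset_repr (right_coset Gam x))) = right_coset GamM (pr x).
Proof.
move=> Px; have [c Gc ->] := coset_repr_rcoset Gam x.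
apply/right_coset_eqP; exists (pr c); first exact: levi_proj_Gam.
by rewrite prM//; exact: GamP.
Qed.

Lemma dcosets_P g c : sg_set P g -> sg_set Gam c -> sg_set P (g * c)%g.
Proof. by move=> Pg /GamP; exact: sgM. Qed.

Lemma dcosets_sub g : sg_set P g -> dcosets Gam g `<=` C.
Proof. by move=> Pg A [c Gc <-]; exists (g * c)%g => //; exact: dcosets_P. Qed.

Lemma levi_pushf_basis g : sg_set P g -> finite_set (dcosets Gam g) ->
  levi_pushf (hecke_basisf R Gam g) (pr g) = (ncard (levi_fibre g))%:R.
Proof.
move=> Pg fg; have fibD : levi_fibre g `<=` dcosets Gam g by move=> A [].
have ff := sub_finite_set fibD fg.
rewrite /levi_pushf (@csumE _ _ _ _
  (fun a => hecke_basisf R Gam g a * levi_ind a (pr g)) (levi_fibre g))//.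
- rewrite -sum1_size natr_sum !big_seq; apply: eq_bigr => A.
  rewrite in_fset_set// inE => -[Ag AE].
  have [_ A_E] := coset_reprP GamP (dcosets_sub Pg Ag).
  rewrite hecke_basisfE A_E asboolT// mul1r /levi_ind asboolT//.
  exact/right_coset_eqE.
- exact: subset_trans fibD (dcosets_sub Pg).
- move=> A CA n0; have [_ A_E] := coset_reprP GamP CA; split.
    apply: contrapT => nA; apply: n0.
    by rewrite hecke_basisfE A_E asboolF// mul0r.
  by apply/esym/levi_ind_neq0 => i0; apply: n0; rewrite i0 mulr0.
Qed.

Lemma proj_meet_conj_subgroup g : sg_set P g ->
  exists K : subgroup X, K = pr @` meet_conj Gam g :> set X.
Proof.
move=> Pg; have [K KE] := meet_conj_subgroup Gam g; rewrite -KE.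
have KP : K `<=` P by move=> x; rewrite KE => -[/GamP].
have K1 : (pr @` K) 1%g.
  by exists 1%g; [exact: sg1 | apply: (levi_proj_id MU1); exact: sg1].
have KM x y : (pr @` K) x -> (pr @` K) y -> (pr @` K) (x * y)%g.
  move=> [a Ka <-] [b Kb <-]; exists (a * b)%g; first exact: sgM.
  by rewrite prM//; exact: KP.
have KV x : (pr @` K) x -> (pr @` K) (x^-1)%g.
  move=> [a Ka <-]; exists (a^-1)%g; first exact: sgV.
  by rewrite (levi_projV MP UnP PMU MU1)//; exact: KP.
by exists (Subgroup K1 KM KV).
Qed.

(** For representatives [a] of [(GamM)_(pr g)] modulo [pr (Gam_(g))] and [b] of
[GamU] modulo [(GamU)_(g)], the fibre over [GamM pr g] consists of the cosets
[Gam g b a], without repetition. Indeed [Gam g c = Gam g c'] means that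
[c c'^-1] is in [Gam_(g)]; applying [pr] determines the class of [a], and then
[b b'^-1] is in [Gam_(g)] and in [U], hence in [(GamU)_(g)] because [U] is
normal in [P]. *)
Lemma ncard_levi_fibre g : sg_set P g ->
  ncard (levi_fibre g) = (nu_index Gam M U g * mu_index Gam U g)%N.
Proof.
move=> Pg; have [Mg _] := prP Pg.
rewrite /nu_index /mu_index /subgroup_index.
have [N NE] := proj_meet_conj_subgroup Pg; rewrite -NE.
have [V VE] := meet_conj_subgroup (sgI Gam U) g; rewrite -[meet_conj (_ `&` U) _]VE.
have [L LE] := meet_conj_subgroup GamM (pr g); rewrite -[meet_conj (_ `&` M) _]LE.
have NL : N `<=` L.
  move=> x; rewrite NE LE => -[h /meet_conjE[Gh Ggh] <-]; apply/meet_conjE.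
  have Ph := GamP Gh; split; first exact: levi_proj_Gam.
  have := levi_proj_Gam Ggh; rewrite prM ?prM//.
  - by rewrite (levi_projV MP UnP PMU MU1).
  - exact: sgM.
  - exact: sgV.
have LP x : sg_set L x ->
    [/\ sg_set GamM x, sg_set GamM (pr g * x * (pr g)^-1)%g & sg_set P x].
  by rewrite LE => /meet_conjE[Gx Gx']; split=> //; exact/GamP/(proj1 Gx).
have VU : V `<=` sgI Gam U by rewrite VE => x [].
rewrite -ncard_setX; first last.
- by exists (right_coset V 1%g), 1%g => //; split; exact: sg1.
- by exists (right_coset N 1%g), 1%g => //; exact: sg1.
(* The first component runs over the classes of [a], the second over those of [b]. *)
apply/esym; apply: (@ncard_set_bij _ _ _ _
  (fun p => right_coset Gam (g * coset_repr p.2 * coset_repr p.1)%g)).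
split.
- move=> [A B] [/= /(coset_reprP NL)[La _] /(coset_reprP VU)[[Gb Ub] _]].
  set a := coset_repr A in La *; set b := coset_repr B in Gb Ub *.
  have [[Ga Ma] Ga' Pa] := LP _ La.
  split; first by exists (b * a)%g; [exact: sgM | rewrite mulgA].
  have Pb := GamP Gb; have Pgb := sgM Pg Pb.
  rewrite right_coset_levi_repr ?prM//; last exact: sgM.
  rewrite (levi_projU MU1 Ub) (levi_proj_id MU1 Ma) mulg1.
  exact/right_coset_eqE.
- move=> [A B] [A' B']; rewrite !inE => -[/= CA CB] [/= CA' CB'].
  have [La AE] := coset_reprP NL CA; have [La' AE'] := coset_reprP NL CA'.
  have [[Gb Ub] BE] := coset_reprP VU CB; have [[Gb' Ub'] BE'] := coset_reprP VU CB'.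
  rewrite -AE -AE' -BE -BE'.
  set a := coset_repr A in La *; set b := coset_repr B in Gb Ub *.
  set a' := coset_repr A' in La' *; set b' := coset_repr B' in Gb' Ub' *.
  have [[Ga Ma] _ Pa] := LP _ La; have [[Ga' Ma'] _ Pa'] := LP _ La'.
  have -> : coset_repr (right_coset N a) = a by rewrite /a AE.
  have -> : coset_repr (right_coset N a') = a' by rewrite /a' AE'.
  have -> : coset_repr (right_coset V b) = b by rewrite /b BE.
  have -> : coset_repr (right_coset V b') = b' by rewrite /b' BE'.
  move=> /right_coset_eqE.
  have -> : (g * b * a * (g * b' * a')^-1 =
             g * (b * (a * a'^-1) * b'^-1) * g^-1)%g.
    by rewrite !invgM !mulgA.
  set h := (b * (a * a'^-1) * b'^-1)%g => Ggh.
  have Gh : sg_set Gam h.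
    by apply: sgM; [apply: sgM => //; apply: sgM => // | ]; exact: sgV.
  have prh : pr h = (a * a'^-1)%g.
    have Paa : sg_set P (a * a'^-1)%g by apply: sgM => //; exact: sgV.
    have Maa : sg_set M (a * a'^-1)%g by apply: sgM => //; exact: sgV.
    have Pb := GamP Gb; have Pb' := sgV (GamP Gb').
    rewrite prM//; last exact: sgM.
    rewrite prM// (levi_projU MU1 Ub) (levi_projU MU1 (sgV Ub')).
    by rewrite mul1g mulg1 (levi_proj_id MU1 Maa).
  have aa : right_coset N a = right_coset N a'.
    by apply/right_coset_eqE; rewrite NE -prh; exists h => //; exact/meet_conjE.
  have aE : a = a' by rewrite /a -AE -/a aa /a' AE'.
  congr pair => //; apply/right_coset_eqE; rewrite VE; apply/meet_conjE.
  have hE : h = (b * b'^-1)%g by rewrite /h aE mulgV mulg1.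
  have Uh : sg_set U h by rewrite hE; apply: sgM => //; exact: sgV.
  rewrite -hE; split; split=> //.
  by have := UnP (sgV Pg) Uh; rewrite conjgE invgK mulgA.
- move=> A [[c Gc <-] /=].
  rewrite right_coset_levi_repr; last exact: dcosets_P.
  have Pc := GamP Gc; rewrite prM// => /right_coset_eqE Gpc.
  have Lc : sg_set L (pr c).
    by rewrite LE; apply/meet_conjE; split=> //; exact: levi_proj_Gam.
  (* The representative of the class of [pr c] is [a = pr x * pr c] with [x] in
     [Gam_(g)], so that [u = x c a^-1] projects to [1] and lies in [GamU]. *)
  have [n Nn aE] := coset_repr_rcoset N (pr c).
  have [x /meet_conjE[Gx Ggx] xn] : (pr @` meet_conj Gam g) n by rewrite -NE.
  set a := coset_repr _ in aE.
  have La : sg_set L a by rewrite aE; apply: sgM => //; exact: NL.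
  have [[Ga Ma] _ Pa] := LP _ La.
  have Px := GamP Gx.
  pose u := (x * c * a^-1)%g.
  have Gu : sg_set Gam u by apply: sgM; [exact: sgM | exact: sgV].
  have Uu : sg_set U u.
    apply: (levi_proj_ker PMU MU1); first exact: GamP.
    rewrite prM//; [|exact: sgM|exact: sgV].
    by rewrite prM// xn -aE (levi_proj_id MU1 (sgV Ma)) mulgV.
  have [y Vy bE] := coset_repr_rcoset V u.
  have /meet_conjE[_ [Ggy _]] : meet_conj (sgI Gam U) g y by rewrite -VE.
  exists (right_coset N (pr c), right_coset V u).
    by split; [exists (pr c) | exists u => //; split].
  rewrite /= -/a bE; apply/right_coset_eqE.
  have -> : (g * (y * u) * a * (g * c)^-1 = (g * y * g^-1) * (g * x * g^-1))%g.
    by rewrite /u invgM !mulgA !mulgVK mulgK.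
  exact: sgM.
Qed.

Lemma dcosets_proj g : sg_set P g -> dcosets GamM (pr g) =
  [set right_coset GamM (pr (coset_repr A)) | A in dcosets Gam g].
Proof.
move=> Pg; apply/seteqP; split=> D.
  move=> [d [Gd Md] <-]; exists (right_coset Gam (g * d)%g); first by exists d.
  rewrite right_coset_levi_repr; last exact: dcosets_P.
  by rewrite prM ?(levi_proj_id MU1 Md)//; exact: GamP.
move=> [A [c Gc <-] <-]; exists (pr c); first exact: levi_proj_Gam.
rewrite right_coset_levi_repr; last exact: dcosets_P.
by rewrite prM//; exact: GamP.
Qed.

(** [Gam g Gam] is the union of its fibres over the cosets [GamM (pr g) d] in
[GamM (pr g) GamM], and right translation by [d] maps the fibre over [GamM (pr g)]
onto the fibre over [GamM (pr g) d]. *)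
Lemma dcosets_finite g : sg_set P g -> finite_set (levi_fibre g) ->
  finite_set (dcosets GamM (pr g)) -> finite_set (dcosets Gam g).
Proof.
move=> Pg ff fM.
pose fib D := [set A | dcosets Gam g A /\ right_coset GamM (pr (coset_repr A)) = D].
apply: (@sub_finite_set _ _ (\bigcup_(D in dcosets GamM (pr g)) fib D)).
  move=> A gA; exists (right_coset GamM (pr (coset_repr A))) => //.
  by rewrite dcosets_proj//; exists A.
apply: bigcup_finite => // D [d [Gd Md] <-].
pose transl A := right_coset Gam (coset_repr A * d)%g.
apply: (sub_finite_set _ (finite_image transl ff)).
move=> A [[c Gc <-]]; rewrite right_coset_levi_repr; last exact: dcosets_P.
have Pc := GamP Gc; have Pd := GamP Gd.
rewrite prM// => /right_coset_eqE; rewrite invgM mulgA => GE.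
have Gcd : sg_set Gam (c * d^-1)%g by apply: sgM => //; exact: sgV.
exists (right_coset Gam (g * (c * d^-1))%g).
  split; first by exists (c * d^-1)%g.
  rewrite right_coset_levi_repr; last exact: dcosets_P.
  rewrite prM//; last exact: GamP.
  rewrite prM//; last exact: sgV.
  by apply/right_coset_eqE; rewrite (levi_proj_id MU1 (sgV Md)) mulgA.
rewrite /transl; have [e Ge ->] := coset_repr_rcoset Gam (g * (c * d^-1))%g.
by apply/right_coset_eqP; exists e => //; rewrite -!mulgA mulVg mulg1.
Qed.

(** * The morphism of Hecke algebras *)

Definition levi_push (f : hecke R GamP) : hecke R GamMM :=
  Hecke GamMM (asboolT (levi_pushf_hecke (heckeP f))).

Fact levi_push_is_linear : linear levi_push.
Proof. by move=> a f g; apply/val_inj/levi_pushf_linear; exact: heckeP. Qed.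

Fact levi_push_is_monoid_morphism : GRing.monoid_morphism levi_push.
Proof.
split; first exact/val_inj/levi_pushf_basis1.
by move=> f g; apply/val_inj/levi_pushf_mul; exact: heckeP.
Qed.

(** Both sides are bi-invariant under [GamM] and supported on the double coset of
[pr g], so it suffices to compare their values at [pr g]. If [T_g] has its
default value [0], then [T_(pr g)] does too or the fibre is infinite. *)
Lemma levi_push_T g : sg_set P g ->
  levi_push (hecke_T R GamP g) =
  (nu_index Gam M U g * mu_index Gam U g)%:R *: hecke_T R GamMM (pr g).
Proof.
move=> Pg; have [Mg _] := prP Pg; rewrite -ncard_levi_fibre//.
have [fg|ifg] := pselect (finite_set (dcosets Gam g)); last first.
  have lin0 : levi_push 0 = 0.
    by have := levi_push_is_linear (-1) 0 0; rewrite scaler0 addr0 scaleN1r addNr.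
  rewrite (hecke_T_infinite R GamP ifg) lin0.
  have [fM|ifM] := pselect (finite_set (dcosets GamM (pr g))); last first.
    by rewrite (hecke_T_infinite R GamMM ifM) scaler0.
  rewrite ncard_infinite ?scale0r// => ff; exact/ifg/dcosets_finite.
have fM : finite_set (dcosets GamM (pr g)).
  by rewrite dcosets_proj//; exact: finite_image.
apply/val_inj/funext => m.
have Hg := hecke_basisf_fun R GamP Pg fg.
have HT := levi_pushf_hecke Hg.
transitivity (levi_pushf (hecke_basisf R Gam g) m).
  by rewrite -(hecke_T_finite R GamP Pg fg).
transitivity ((ncard (levi_fibre g))%:R * hecke_basisf R GamM (pr g) m); last first.
  by rewrite -(hecke_T_finite R GamMM Mg fM).
rewrite hecke_basisfE; case: asboolP => [/dcosetsP[c [d [Gc Gd ->]]]|nm].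
  by rewrite (hecke_right HT _ Gd) (hecke_left HT _ Gc) levi_pushf_basis// mulr1.
rewrite mulr0; apply: contrapT => /levi_pushf_neq0[A [CA fA mE]]; apply: nm.
rewrite mE dcosets_proj//; exists A => //.
have [_ AE] := coset_reprP GamP CA; rewrite -AE.
by apply: contrapT => nA; move: fA; rewrite hecke_basisfE asboolF// eqxx.
Qed.

End LeviPush.

(** * Rational points of a Levi decomposition *)

Section RationalPoints.
Variables (F : fieldType) (K : closedFieldType) (iota : {rmorphism F -> K}).
Variable n : nat.
Implicit Types (g h : GL n F) (P U M : subgroup (GL n K)).

Fact gl_map_subproof g : map_mx iota (gl_val g) \in unitmx.
Proof. by rewrite map_unitmx gl_unit. Qed.

Definition gl_map g : GL n K := GLmx (gl_map_subproof g).

Lemma gl_mapM g h : gl_map (g * h)%g = (gl_map g * gl_map h)%g.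
Proof. by apply: val_inj; rewrite /= map_mxM. Qed.

Lemma gl_map1 : gl_map 1%g = 1%g.
Proof. by apply: val_inj; rewrite /= map_mx1. Qed.

Lemma gl_mapV g : gl_map (g^-1)%g = (gl_map g)^-1%g.
Proof. by apply: val_inj; rewrite /= map_invmx. Qed.

Lemma gl_map_inj : injective gl_map.
Proof.
move=> g h /(congr1 (fun x => gl_val x)) /= E; apply: val_inj.
exact: (map_mx_inj (f := iota)).
Qed.

Lemma F_pointsE P g : F_points_set iota P g <-> sg_set P (gl_map g).
Proof.
split=> [[h Ph hE]|Pg]; last by exists (gl_map g).
by rewrite (_ : gl_map g = h)//; apply: val_inj; rewrite /= hE.
Qed.

Lemma mx_eval_base_change (p : mpoly (n * n) F) g :
  mx_eval (base_change iota p) (gl_map g) = iota (mx_eval p g).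
Proof.
rewrite /mx_eval /base_change !mevalE rmorph_sum/=.
rewrite (perm_big _ (msupp_map_mpoly _ (fmorph_inj iota)))/=.
apply: eq_bigr => m _; rewrite rmorphM rmorph_prod mcoeff_map_mpoly.
congr (_ * _); apply: eq_bigr => i _.
by rewrite -map_mxvec mxE rmorphXn.
Qed.

(** The entries of the image are values of rational functions with coefficients
in [F] at an [F]-rational point, hence lie in [F]; the matrix over [F] that they
form is invertible because its base change to [K] is. *)
Lemma F_morphism_rational (X Y : set (GL n K)) phi g :
  F_morphism iota X Y phi -> X (gl_map g) ->
  exists h, phi (gl_map g) = gl_map h.
Proof.
move=> [_ rat] Xg.
have /choice[c cE] : forall ij : 'I_n * 'I_n, exists c : F,
    gl_val (phi (gl_map g)) ij.1 ij.2 = iota c.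
  move=> [i j]; have [p [e ->//]] := rat i j.
  exists (mx_eval p g / \det (gl_val g) ^+ e).
  by rewrite mx_eval_base_change /= det_map_mx fmorph_div rmorphXn.
pose A := \matrix_(i, j) c (i, j).
have AE : gl_val (phi (gl_map g)) = map_mx iota A.
  by apply/matrixP => i j; rewrite !mxE (cE (i, j)).
have Au : A \in unitmx by rewrite -(map_unitmx iota) -AE gl_unit.
by exists (GLmx Au); apply: val_inj.
Qed.

(** The [M]-component of a rational point is its image under the projection, which
is defined over [F]; the [U]-component is then a quotient of rational points. *)
Lemma F_points_levi P U M : levi_F_subgroup iota P U M ->
  forall g, sg_set (F_points iota P) g -> exists m u,
    [/\ sg_set (F_points iota M) m, sg_set (F_points iota U) u & g = (m * u)%g].
Proof.
move=> [_ PE _ [pr prF prE]] g /F_pointsE Pg.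
have [m mE] := F_morphism_rational prF Pg.
move: (Pg); rewrite PE => -[m' Mm [u Uu mug]].
have mm : m' = gl_map m by rewrite -mE -mug prE.
exists m, (m^-1 * g)%g; split; last by rewrite mulVKg.
- by apply/F_pointsE; rewrite -mm.
- by apply/F_pointsE; rewrite gl_mapM gl_mapV -mm -mug mulKg.
Qed.

Lemma F_points_sub (P Q : subgroup (GL n K)) : P `<=` Q ->
  F_points iota P `<=` F_points iota Q.
Proof. by move=> PQ g /F_pointsE Pg; apply/F_pointsE/PQ. Qed.

Lemma F_points_normalised P U :
  normalised_by P U -> normalised_by (F_points iota P) (F_points iota U).
Proof.
move=> nPU s a /F_pointsE Ps /F_pointsE Ua; apply/F_pointsE.
by rewrite conjgE !gl_mapM gl_mapV -conjgE; exact: nPU.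
Qed.

Lemma F_points_setI1 M U : M `&` U = [set 1%g] ->
  F_points iota M `&` F_points iota U `<=` [set 1%g].
Proof.
move=> MU g [/F_pointsE Mg /F_pointsE Ug]; apply: gl_map_inj.
by rewrite gl_map1; have : (M `&` U) (gl_map g) by []; rewrite MU.
Qed.

End RationalPoints.

Theorem proposition4p3
  (RR : realType) (F : topFieldType)
  (F_local : locally_compact_nonarchimedean RR F)
  (K : closedFieldType) (iota : {rmorphism F -> K})
  (n : nat) (G B T P U M : subgroup (GL n K))
  (G_reductive : connected_reductive_F_group iota G)
  (B_minimal : minimal_parabolic_F_subgroup iota G B)
  (T_maximal : maximal_F_split_torus iota G T)
  (T_in_B : T `<=` B)
  (P_parabolic : parabolic_F_subgroup iota G P)
  (P_standard : B `<=` P)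
  (U_radical : is_unipotent_radical P U)
  (M_levi : levi_F_subgroup iota P U M)
  (M_standard : centralizer G T `<=` M)
  (R : comPzRingType)
  (Gam : subgroup (GL n F))
  (Gam_in_P : Gam `<=` F_points iota P)
  (Gam_compact_open : compact_open_in (F_points iota P : set (GL n F)) Gam)
    (Gam_decomposition :
    Gam = [set (m * u)%g | m in sgI Gam (F_points iota M) &
                              u in sgI Gam (F_points iota U)] :> set (GL n F)) :
  let GamM_in_M := @sgI_subr _ Gam (F_points iota M) in
  let pr := levi_proj (F_points iota M) (F_points iota U) in
  let nu := nu_index Gam (F_points iota M) (F_points iota U) in
  let mu := mu_index Gam (F_points iota U) in
  exists Theta : {linear hecke R Gam_in_P -> hecke R GamM_in_M},
    [/\ forall g, sg_set (F_points iota P) g ->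
          Theta (hecke_T R Gam_in_P g) =
            (nu g * mu g)%:R *: hecke_T R GamM_in_M (pr g),
        forall Theta' : {linear hecke R Gam_in_P -> hecke R GamM_in_M},
          (forall g, sg_set (F_points iota P) g ->
            Theta' (hecke_T R Gam_in_P g) =
              (nu g * mu g)%:R *: hecke_T R GamM_in_M (pr g)) ->
          Theta' =1 Theta
      & GRing.monoid_morphism Theta].
Proof.
move=> GamM_in_M pr nu mu.
have [_ PE MU1 _] := M_levi.
have [[U_sub U_norm _ _ _] _] := U_radical.
have MP : F_points iota M `<=` F_points iota P.
  apply: F_points_sub => m Mm; rewrite PE; exists m => //.
  by exists 1%g; [exact: sg1 | rewrite mulg1].
have UnP := F_points_normalised (iota := iota) U_norm.
have PMU := F_points_levi M_levi.
have MU := F_points_setI1 (iota := iota) MU1.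
have GamMU : Gam `<=` [set (m * u)%g | m in sgI Gam (F_points iota M) &
    u in sgI Gam (F_points iota U)].
  by rewrite -Gam_decomposition.
pose Theta := @levi_push _ _ _ _ MP UnP PMU MU R _ Gam_in_P GamMU.
pose lin := GRing.isLinear.Build _ _ _ _ Theta
  (@levi_push_is_linear _ _ _ _ MP UnP PMU MU R _ Gam_in_P GamMU).
pose Theta_lin : {linear hecke R Gam_in_P -> hecke R GamM_in_M} :=
  HB.pack Theta lin.
have Theta_T g : sg_set (F_points iota P) g ->
    Theta_lin (hecke_T R Gam_in_P g) =
    (nu g * mu g)%:R *: hecke_T R GamM_in_M (pr g).
  exact: levi_push_T.
exists Theta_lin; split=> //.
- move=> Theta' Theta'_T; apply: hecke_linear_ext => g Pg.
  by rewrite Theta'_T// Theta_T.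
- exact: levi_push_is_monoid_morphism.
Qed.
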